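(* Let $a,b$ be integers and let $(u_n)_{n\ge 0}$ be the integer sequence with $u_0=0$, $u_1=1$, $u_{n+2}=a u_{n+1}+b u_n$ for all $n\ge 0$. Assume $(u_n)$ is nondegenerate, i.e. $b\neq 0$ and the ratio $\alpha/\beta$ of the two complex roots $\alpha,\beta$ of $x^2-ax-b$ is not a root of unity. If $k\ge 2$ is an integer with $\gcd(k,b)=1$, then the sequence $\nu_k(u_{n+1})_{n\ge 0}$ is $k$-regular.
   Context: For integers $k\ge 2$ and $n\neq 0$, $\nu_k(n)$ denotes the greatest nonnegative integer $e$ such that $k^e\mid n$. For a sequence of integers $s(n)_{n\ge 0}$, its $k$-kernel is the set of subsequences $\{s(k^e n+i)_{n\ge 0} : e\ge 0,\ 0\le i<k^e\}$. The sequence is called $k$-regular if the $\mathbb{Z}$-module generated by its $k$-kernel (inside the $\mathbb{Z}$-module of all integer sequences) is finitely generated; in that case its rank is the rank of this $\mathbb{Z}$-module. *)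

(* Defs.v *)
From mathcomp Require Import all_boot all_order all_algebra all_field.
From mathcomp Require Import boolp classical_sets functions.
Set Implicit Arguments.
Unset Strict Implicit.
Unset Printing Implicit Defensive.
Import Order.TTheory GRing.Theory Num.Theory.

Local Open Scope classical_set_scope.
Local Open Scope ring_scope.

(* For 1 < k and n != 0, k ^ e %| n forces e < k ^ e <= `|n|, so the bound on
   the range of e loses nothing (see nuP); the value at n = 0 is a dummy 0. *)
Definition nu (k : nat) (n : int) : nat :=
  \max_(e < `|n|.+1 | (k%:Z ^+ e %| n)%Z) e.

Lemma nuP (k : nat) (n : int) (e : nat) : (1 < k)%N -> n != 0 ->
  (k%:Z ^+ e %| n)%Z = (e <= nu k n)%N.
Proof.
move=> k_gt1 n_neq0; apply/idP/idP => [ke_n | le_e].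
  have lt_e : (e < `|n|.+1)%N.
    apply/ltnW; apply: leq_ltn_trans (ltn_expl e k_gt1) _; rewrite ltnS.
    by apply: dvdn_leq; rewrite ?absz_gt0 //; move: ke_n; rewrite dvdzE abszX.
  exact: (leq_bigmax_cond (Ordinal lt_e)).
suff nu_n : (k%:Z ^+ nu k n %| n)%Z by apply: dvdz_trans nu_n; apply: dvdz_exp2l.
rewrite /nu; elim/big_ind: _ => [|x y dx dy|i //]; first by rewrite expr0 dvd1z.
by rewrite /maxn; case: ifP.
Qed.

Definition nondegenerate_recurrence (a b : int) : Prop :=
  b != 0 /\
  forall alpha beta : algC,
    'X^2 - a%:~R *: 'X - (b%:~R)%:P = ('X - alpha%:P) * ('X - beta%:P) ->
    forall m : nat, (0 < m)%N -> ~~ m.-unity_root (alpha / beta).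

Definition k_kernel (k : nat) (s : nat -> int) : set (nat -> int) :=
  [set t | exists e i : nat,
     (i < k ^ e)%N /\ t = (fun n => s (k ^ e * n + i)%N)].

Definition Zspan (V : zmodType) (S : set V) : set V :=
  [set v | exists m (X : m.-tuple V), (forall i, S (tnth X i)) /\ inIntSpan X v].

Definition fin_gen (V : zmodType) (M : set V) : Prop :=
  exists m (X : m.-tuple V), M = [set v | inIntSpan X v].

Definition k_regular (k : nat) (s : nat -> int) : Prop :=
  fin_gen (Zspan (k_kernel k s)).

(* Main.v *)
(* k ^ d divides u_n exactly when the rank of apparition of k ^ d divides n,
   and these ranks are eventually geometric: lifting the exponent at the primes
   p | k, starting from a term divisible by k ^ 2, gives E and T with
   k ^ (E + t) | u_n <-> k ^ t * T | n for all t.  Hence the sequence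
   nu_k(u_(k^e * n + j)) is T-periodic in n when 0 < j < k ^ e, while
   nu_k(u_(k^e * m)) - nu_k(u_m) is T-periodic in m.  The k-kernel thus lies in
   the Z-module generated by the sequence itself and the T-periodic sequences,
   and submodules of finitely generated Z-modules are finitely generated. *)
Require Import Defs.
From mathcomp Require Import all_boot all_order all_algebra all_field.
From mathcomp Require Import boolp classical_sets functions.
From mathcomp Require Import ring zify.
Import Order.TTheory GRing.Theory Num.Theory.
Local Open Scope ring_scope.

(** * Integer spans and subgroups of finitely generated abelian groups *)

Lemma inIntSpan0 (V : zmodType) (m : nat) (X : m.-tuple V) : inIntSpan X 0.
Proof. by exists [ffun=> 0]; rewrite big1 // => i _; rewrite ffunE mulr0z. Qed.

Lemma inIntSpanB (V : zmodType) (m : nat) (X : m.-tuple V) (v w : V) :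
  inIntSpan X v -> inIntSpan X w -> inIntSpan X (v - w).
Proof.
move=> [c ->] [d ->]; exists [ffun i => c i - d i]; rewrite -sumrB.
by apply: eq_bigr => i _; rewrite ffunE mulrzBr.
Qed.

Lemma inIntSpan_cons (V : zmodType) (m : nat) (x : V) (X : m.-tuple V) (v : V) :
  inIntSpan [tuple of x :: X] v <-> exists c, inIntSpan X (v - x *~ c).
Proof.
split=> [[d ->]|[c [d v_eq]]].
  exists (d ord0), [ffun i => d (lift ord0 i)].
  rewrite big_ord_recl /= addrC addKr.
  by apply: eq_bigr => i _; rewrite ffunE.
exists [ffun i => if unlift ord0 i is Some j then d j else c].
rewrite big_ord_recl /= ffunE unlift_none.
rewrite -[LHS](subrK (x *~ c)) v_eq addrC; congr (_ + _).
by apply: eq_bigr => i _; rewrite ffunE liftK.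
Qed.

Lemma zmod_set_mulrz (V : zmodType) (N : set V) (v : V) (c : int) :
    N 0 -> (forall x y, N x -> N y -> N (x - y)) -> N v -> N (v *~ c).
Proof.
move=> N0 NB Nv.
have NN x : N x -> N (- x) by rewrite -sub0r; apply: NB.
have Nn n : N (v *+ n).
  elim: n => [|n IHn]; first by rewrite mulr0n.
  by rewrite mulrSr -[v in _ + v]opprK; apply/NB/NN.
by case: c => n; [exact: Nn | rewrite NegzE mulrNz; apply/NN/Nn].
Qed.

(* Z is Noetherian: by induction on the number of generators, using that the
   coefficients of the first generator form an ideal of Z. *)
Lemma fin_gen_sub (V : zmodType) (m : nat) (X : m.-tuple V) (N : set V) :
    N 0 -> (forall x y, N x -> N y -> N (x - y)) ->
    (forall x, N x -> inIntSpan X x) ->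
  fin_gen N.
Proof.
elim: m X N => [|m IHm] X N N0 NB NX.
  exists 0, X; apply/seteqP; split=> [v /NX //|v [c]].
  by rewrite big_ord0 => ->.
case/tupleP: X NX => x X NX.
(* The generators may be dependent, so a first coefficient is not determined by the element:
   [lead n] asks for some representation. Negating elements reduces to natural [n]. *)
pose lead n := exists2 v, N v & inIntSpan X (v - x *~ n%:Z).
have lead_int v (c : int) : N v -> inIntSpan X (v - x *~ c) -> lead `|c|%N.
  move=> Nv Xv; case: (intP c) Xv => [|n|n] Xv; [by exists v|by exists v|].
  exists (- v); first by rewrite -sub0r; apply: NB.
  have -> : - v - x *~ `|- n.+1%:Z|%N = 0 - (v - x *~ (- n.+1%:Z)).
    by rewrite abszN absz_nat mulrNz opprK sub0r opprD.
  by apply: inIntSpanB => //; apply: inIntSpan0.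
have [exn|nexn] := pselect (exists n, (0 < n)%N && `[< lead n >]); last first.
  apply: (IHm X) => // v Nv; have /inIntSpan_cons [c Xv] := NX v Nv.
  case: (eqVneq c 0) Xv => [->|c_neq0 Xv]; first by rewrite mulr0z subr0.
  case: nexn; exists `|c|%N; rewrite absz_gt0 c_neq0.
  by apply/asboolP/lead_int/Xv.
case: (ex_minnP exn) => n /andP[n_gt0 /asboolP[v0 Nv0 Xv0]] n_min.
pose N' := [set v | N v /\ inIntSpan X v]%classic.
have [m' [Y N'Y]] : fin_gen N'.
  apply: (IHm X) => [|v w [Nv Xv] [Nw Xw]|v []] //.
    by split=> //; apply: inIntSpan0.
  by split; [apply: NB|apply: inIntSpanB].
exists m'.+1, [tuple of v0 :: Y]; apply/seteqP; split=> v /=.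
  move=> Nv; apply/inIntSpan_cons; have /inIntSpan_cons [c Xv] := NX v Nv.
  have r_ge0 : 0 <= (c %% n)%Z by rewrite modz_ge0 // -lt0n.
  have r_lt : (c %% n)%Z < n by apply: ltz_pmod.
  move: (divz_eq c n) r_ge0 r_lt; set q := (c %/ n)%Z; set r := (c %% n)%Z.
  clearbody q r => c_eq r_ge0 r_lt.
  (* Subtracting [q] copies of [v0] leaves the first coefficient [r], smaller than the least
     positive one [n]; so [r] is 0 and the difference lies in [N']. *)
  exists q; suff : N' (v - v0 *~ q) by rewrite N'Y.
  have NB' : N (v - v0 *~ q).
    by apply: (NB) => //; exact: (zmod_set_mulrz _ _ _ _ N0 NB Nv0).
  split=> //.
  have Xr : inIntSpan X (v - v0 *~ q - x *~ r).
    have -> : v - v0 *~ q - x *~ r = (v - x *~ c) - (v0 - x *~ n%:Z) *~ q.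
      rewrite c_eq mulrzDr mulrzBl -mulrzA mulrC.
      rewrite opprB opprD -!addrA (addrCA (- (x *~ r))) addKr.
      by rewrite (addrC (- (x *~ r))).
    apply: inIntSpanB => //.
    apply: (@zmod_set_mulrz _ [set w | inIntSpan X w]%classic) => //=.
      exact: inIntSpan0.
    exact: inIntSpanB.
  have := lead_int _ _ NB' Xr; case: (eqVneq r 0) Xr => [->|r_neq0 Xr lead_r].
    by rewrite mulr0z subr0.
  have := n_min `|r|%N; rewrite absz_gt0 r_neq0 /=.
  by move=> /(_ (asboolT lead_r)); lia.
move=> /inIntSpan_cons [c Yv]; have [NB' _] : N' (v - v0 *~ c) by rewrite N'Y.
rewrite -[v](subrK (v0 *~ c)) -[v0 *~ c]opprK; apply: (NB); rewrite ?opprK //.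
by rewrite -mulrNz; exact: (zmod_set_mulrz _ _ _ _ N0 NB Nv0).
Qed.

Lemma inIntSpan_cat (V : zmodType) (m p : nat) (X : m.-tuple V)
    (Y : p.-tuple V) (v w : V) :
  inIntSpan X v -> inIntSpan Y w -> inIntSpan [tuple of X ++ Y] (v + w).
Proof.
move=> [c ->] [d ->].
exists [ffun i : 'I_(m + p) =>
  match fintype.split i with inl j => c j | inr j => d j end].
rewrite big_split_ord /=; congr (_ + _); apply: eq_bigr => i _; rewrite ffunE.
  by rewrite -/(unsplit (inl i)) unsplitK nth_cat size_tuple ltn_ord.
by rewrite -/(unsplit (inr i)) unsplitK nth_cat size_tuple ltnNge leq_addr /= addKn.
Qed.

Lemma ZspanB (V : zmodType) (S : set V) (v w : V) :
  Zspan S v -> Zspan S w -> Zspan S (v - w).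
Proof.
move=> [m [X [SX Xv]]] [p [Y [SY Yw]]]; exists (m + p)%N, [tuple of X ++ Y].
split=> [i|].
  have : tnth [tuple of X ++ Y] i \in X ++ Y by apply: mem_tnth.
  by rewrite mem_cat => /orP[] /tnthP[j ->].
apply: inIntSpan_cat => //; rewrite -[- w]sub0r.
by apply: inIntSpanB => //; apply: inIntSpan0.
Qed.

(** [Zspan S] is a subgroup of the span of [X], so the Noetherian property applies to it. *)
Lemma fin_gen_Zspan (V : zmodType) (m : nat) (X : m.-tuple V) (S : set V) :
  (forall v, S v -> inIntSpan X v) -> fin_gen (Zspan S).
Proof.
move=> SX; apply: (fin_gen_sub V m X) => [|v w|v [p [Y [SY [c ->]]]]].
- by exists 0%N, [tuple]; split; [case|apply: inIntSpan0].
- exact: ZspanB.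
elim/big_ind: _ => [|x y Xx Xy|i _]; first exact: inIntSpan0.
- rewrite -[y]opprK -[- y]sub0r; apply: inIntSpanB => //.
  by apply: inIntSpanB => //; apply: inIntSpan0.
apply: (zmod_set_mulrz V [set w | inIntSpan X w]%classic) => /=.
- exact: inIntSpan0.
- exact: inIntSpanB.
by rewrite -tnth_nth; apply: SX.
Qed.

(** * Periodic sequences and a criterion for k-regularity *)

(** The generators are the indicators of the residue classes mod [T]; the coefficients are the
    values of [t] at 0, ..., [T] - 1. *)
Lemma periodic_span (T : nat) (t : nat -> int) :
    (0 < T)%N -> (forall n, t (n + T)%N = t n) ->
  inIntSpan [tuple of mkseq (fun r n => ((n %% T)%N == r)%:Z) T] t.
Proof.
move=> T_gt0 t_per; exists [ffun i : 'I_T => t i]; apply/funext => n.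
have fct_mulrz (f : nat -> int) (c : int) : (f *~ c) n = f n * c.
  have fct_mulrn p : (f *+ p) n = f n * p%:Z.
    elim: p => [|p IHp]; first by rewrite mulr0.
    by rewrite mulrSr -[LHS]/((f *+ p) n + f n) IHp intS mulrDr mulr1 addrC.
  by case: c => p; rewrite ?NegzE ?mulrNz ?mulrN -fct_mulrn.
have t_mod : t (n %% T)%N = t n.
  rewrite [in RHS](divn_eq n T) addnC.
  by elim: (n %/ T)%N => [|q IHq]; rewrite ?addn0 // mulSnr addnA t_per.
rewrite fct_sumE (bigD1 (Ordinal (ltn_pmod n T_gt0))) //= big1 => [|i ne_i].
  by rewrite addr0 fct_mulrz ffunE nth_mkseq ?ltn_pmod //= eqxx mul1r.
rewrite fct_mulrz nth_mkseq //=; case: eqP => [eq_i|_]; last by rewrite mul0r.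
by case/eqP: ne_i; apply: val_inj; rewrite /= eq_i.
Qed.

(** Here [w n] stands for nu_k(u_n) and is handled through its levels [d <= w n]: the low ones are
    [T]-periodic, the high ones are divisibility conditions on [n]. Each kernel element is then 0 or
    1 times the sequence itself plus a [T]-periodic sequence. *)
Lemma k_regular_of_periodicity (k E T : nat) (w : nat -> nat) :
    (1 < k)%N -> (0 < T)%N ->
    (forall d n, (d <= E)%N -> (0 < n)%N -> (d <= w (n + T)%N)%N = (d <= w n)%N) ->
    (forall t n, (0 < n)%N -> (E + t <= w n)%N = (k ^ t * T %| n)%N) ->
  k_regular k (fun n => (w n.+1)%:Z).
Proof.
move=> k_gt1 T_gt0 w_per w_div.
have k_gt0 : (0 < k)%N by apply: ltnW.
have eqw x y : (forall d, (d <= x)%N = (d <= y)%N) -> x = y.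
  by move=> xy; apply/eqP; rewrite eqn_leq -xy leqnn xy leqnn.
have w_per_iter d n c : (d <= E)%N -> (0 < n)%N ->
    (d <= w (n + c * T)%N)%N = (d <= w n)%N.
  move=> dE n_gt0; elim: c => [|c IHc]; rewrite ?addn0 // mulSnr addnA w_per //.
  by rewrite addn_gt0 n_gt0.
(* A level [d] strictly above [E] means divisibility by k^(d-E) T, which divides k^e T. *)
have w_per_exp e d n : (d <= E + e)%N -> (0 < n)%N ->
    (d <= w (n + k ^ e * T)%N)%N = (d <= w n)%N.
  move=> dEe n_gt0; case: (leqP d E) => [dE|Ed]; first exact: w_per_iter.
  rewrite -(subnKC (ltnW Ed)) !w_div ?addn_gt0 ?n_gt0 //.
  by rewrite dvdn_addl // dvdn_mul // dvdn_exp2l; lia.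
pose s n := (w n.+1)%:Z.
pose X := [tuple of s :: mkseq (fun r n => ((n %% T)%N == r)%:Z) T].
apply: (fin_gen_Zspan _ _ X) => _ [e [i [lt_i ->]]].
(* Because of the shift in [w n.+1], the relevant residue is [i.+1]: only i = k^e - 1 gives indices
   divisible by k^e. *)
apply/inIntSpan_cons; case: (ltnP i.+1 (k ^ e)) => [lt_i1|ge_i1].
  exists 0; rewrite mulr0z subr0; apply: periodic_span => // n.
  congr Posz; apply: eqw => d.
  case: (leqP d (E + e)) => [dEe|Eed].
    have -> : (k ^ e * (n + T) + i).+1 = ((k ^ e * n + i).+1 + k ^ e * T)%N by lia.
    exact: w_per_exp.
  (* A level above [E + e] would make k^e divide the index, hence [i.+1], which is positive and
     smaller than k^e. *)
  have ndvd m : (d <= w (k ^ e * m + i).+1)%N = false.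
    have -> : d = (E + (d - E))%N by lia.
    rewrite w_div //; apply/negbTE/negP => dvd_m.
    have : (k ^ e %| (k ^ e * m + i).+1)%N.
      by apply: dvdn_trans dvd_m; rewrite dvdn_mulr // dvdn_exp2l; lia.
    by rewrite -addnS dvdn_addr ?dvdn_mulr // => /dvdn_leq; lia.
  by rewrite !ndvd.
have i1 : i.+1 = (k ^ e)%N by lia.
(* After subtracting the sequence itself, the value at [n] is [e] when [T] divides [n.+1]; otherwise
   both terms stay below [E + e] and [E], where all levels are periodic. *)
exists 1; rewrite mulr1z; apply: periodic_span => // n.
have kE m : (k ^ e * m + i).+1 = (k ^ e * m.+1)%N by lia.
pose c m : int := if (T %| m.+1)%N then e%:Z else 0.
have ke_gt0 : (0 < k ^ e)%N by rewrite expn_gt0 k_gt0.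
have w_mul m : (T %| m.+1)%N -> w (k ^ e * m.+1)%N = (w m.+1 + e)%N.
  move=> Tm; have Ew := w_div 0%N m.+1 isT; rewrite expn0 mul1n addn0 Tm in Ew.
  have Eew : (E + e <= w (k ^ e * m.+1)%N)%N.
    by rewrite w_div ?muln_gt0 ?ke_gt0 // dvdn_pmul2l.
  apply: eqw => d; case: (leqP d (E + e)) => dEe.
    by rewrite !(leq_trans dEe) // leq_add2r.
  have -> : d = (E + (d - E - e) + e)%N by lia.
  rewrite leq_add2r [RHS]w_div // -addnA w_div ?muln_gt0 ?ke_gt0 //.
  rewrite addnC expnD -mulnA.
  by rewrite dvdn_pmul2l.
rewrite /s !fctE /=.
change ((w (k ^ e * (n + T)%N + i).+1)%:Z - (w (n + T)%N.+1)%:Z =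
        (w (k ^ e * n + i).+1)%:Z - (w n.+1)%:Z).
rewrite !kE; case: (boolP (T %| n.+1)%N) => Tn.
  rewrite !w_mul // -?addSn ?dvdn_addl //; lia.
have TnT : ~~ (T %| (n + T).+1)%N by rewrite -addSn dvdn_addl.
have small m : ~~ (T %| m.+1)%N ->
    (w m.+1 < E)%N /\ (w (k ^ e * m.+1) < E + e)%N.
  move=> Tm; rewrite !ltnNge; split.
    by have := w_div 0%N m.+1 isT; rewrite expn0 mul1n addn0 => ->.
  by rewrite w_div ?muln_gt0 ?ke_gt0 // dvdn_pmul2l.
have [w1 w2] := small _ Tn; have [w3 w4] := small _ TnT.
have -> : w (n + T).+1 = w n.+1.
  apply: eqw => d; rewrite -addSn; case: (leqP d E) => [dE|Ed]; first exact: w_per.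
  by rewrite addSn; lia.
suff -> : w (k ^ e * (n + T).+1)%N = w (k ^ e * n.+1)%N by [].
apply: eqw => d; case: (leqP d (E + e)) => [dE|Ed]; last lia.
by rewrite -addSn mulnDr w_per_exp // muln_gt0 ke_gt0.
Qed.

(** * Addition formula, coprimality and rank of apparition for Lucas sequences *)

Lemma dvdz_addr (d x y : int) : (d %| y)%Z -> (d %| x + y)%Z = (d %| x)%Z.
Proof. exact: rpredDr. Qed.

Definition lucas_sequence (a b : int) (u : nat -> int) : Prop :=
  [/\ u 0%N = 0, u 1%N = 1 & forall n, u n.+2 = a * u n.+1 + b * u n].

(** The factor [u n.+1 - a * u n] is b u_(n-1), written so as to make sense at n = 0. The two
    identities are proved together since the recurrence has order two. *)
Lemma lucas_addn (a b : int) (u : nat -> int) (m n : nat) :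
    lucas_sequence a b u ->
  u (m + n)%N = u m.+1 * u n + u m * (u n.+1 - a * u n) /\
  u (m + n).+1 = u m.+1 * u n.+1 + b * u m * u n.
Proof.
move=> [u0 u1 uS]; elim: m => [|m [IH1 IH2]].
  by rewrite u0 u1 add0n; split; ring.
by rewrite addSn (uS (m + n)%N) IH1 IH2 (uS m); split; ring.
Qed.

(** The left side is (u_(n+1) - alpha u_n)(u_(n+1) - beta u_n) = beta^n alpha^n, and alpha beta =
    -b. *)
Lemma lucas_norm (a b : int) (u : nat -> int) (n : nat) :
    lucas_sequence a b u ->
  u n.+1 ^+ 2 - a * u n * u n.+1 - b * u n ^+ 2 = (- b) ^+ n.
Proof.
move=> [u0 u1 uS]; elim: n => [|n IHn].
  by rewrite u0 u1 expr0; ring.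
by rewrite [RHS]exprS -IHn uS; ring.
Qed.

(** Modulo [d] the norm identity makes u_(n+1)^2 equal to the unit (-b)^n. *)
Lemma lucas_coprime_succ (a b : int) (u : nat -> int) (n : nat) (d : int) :
    lucas_sequence a b u -> coprimez d b -> (d %| u n)%Z ->
  coprimez d (u n.+1).
Proof.
move=> Lu db /dvdzP[q un].
have := lucas_norm _ _ _ n Lu.
rewrite -(coprimez_pexpr (k := 2)) // => norm.
have -> : u n.+1 ^+ 2 = (q * (a * u n.+1 + b * u n)) * d + (- b) ^+ n.
  by rewrite -norm un; ring.
rewrite /coprimez gcdzMDl -/(coprimez _ _); apply: coprimezXr.
by rewrite coprimezE abszN -coprimezE.
Qed.

(** Modulo [d] the addition formula becomes u_(m+n) = u_m u_(n+1), where u_(n+1) is a unit. *)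
Lemma lucas_dvdz_addn (a b : int) (u : nat -> int) (m n : nat) (d : int) :
    lucas_sequence a b u -> coprimez d b -> (d %| u n)%Z ->
  (d %| u (m + n)%N)%Z = (d %| u m)%Z.
Proof.
move=> Lu db d_un; have [-> _] := lucas_addn _ _ _ m n Lu.
have := lucas_coprime_succ _ _ _ _ _ Lu db d_un.
case/dvdzP: d_un => q un d_un1.
have -> : u m.+1 * u n + u m * (u n.+1 - a * u n) =
          u m * u n.+1 + ((u m.+1 - a * u m) * q) * d by rewrite un; ring.
by rewrite dvdz_addr; [apply: Gauss_dvdzl|apply: dvdz_mull].
Qed.

(** The pairs (u_n, u_(n+1)) mod [d] form an orbit of the map [f] on a finite set. As [b] is a unit
    mod [d], [f] is injective, so the orbit returns to its start (0, 1). *)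
Lemma lucas_apparition (a b : int) (u : nat -> int) (d : nat) :
    lucas_sequence a b u -> (1 < d)%N -> coprimez d%:Z b ->
  exists2 n, (0 < n)%N & (d%:Z %| u n)%Z.
Proof.
move=> [u0 u1 uS] d_gt1 db.
pose R := 'Z_d; pose f (x : R * R) : R * R := (x.2, a%:~R * x.2 + b%:~R * x.1).
have b_unit : (b%:~R : R) \is a GRing.unit.
  have bE : (`|b|%N%:R : R) \is a GRing.unit.
    by rewrite unitZpE //; rewrite coprimezE in db.
  move: bE; case: b {db uS f} => n //.
  by rewrite NegzE abszN mulrNz unitrN.
have f_inj : injective f.
  move=> [x1 x2] [y1 y2] fxy; have e2 : x2 = y2 := congr1 fst fxy.
  have := congr1 snd fxy; rewrite /f /= e2 => e1.
  by rewrite (mulrI b_unit (addrI _ e1)).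
have iter_f n : iter n f (0, 1) = ((u n)%:~R, (u n.+1)%:~R).
  elim: n => [|n /= ->]; first by rewrite u0 u1.
  by rewrite /f /= uS rmorphD !rmorphM.
exists (order f (0, 1)); first exact: order_gt0.
have := iter_order f_inj (0, 1); rewrite iter_f => -[un _].
have : (`|u (order f (0, 1)%R)|%N%:R : R) = 0.
  move: un; case: (u _) => n // /eqP.
  by rewrite NegzE abszN mulrNz oppr_eq0 => /eqP.
move/(congr1 val); rewrite /= val_Zp_nat // => dvd_un.
by rewrite dvdzE absz_nat /dvdn dvd_un.
Qed.

(** Take the least positive index as [r]. Shifts by [r] preserve divisibility, so only [n %% r]
    counts, and minimality forces it to be 0. *)
Lemma lucas_rank (a b : int) (u : nat -> int) (d : nat) :
    lucas_sequence a b u -> (1 < d)%N -> coprimez d%:Z b ->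
  exists2 r, (0 < r)%N & forall n, (d%:Z %| u n)%Z = (r %| n)%N.
Proof.
move=> Lu d_gt1 db; have [n n_gt0 dn] := lucas_apparition _ _ _ _ Lu d_gt1 db.
have ex_n : exists n, (0 < n)%N && (d%:Z %| u n)%Z by exists n; rewrite n_gt0.
case: (ex_minnP ex_n) => r /andP[r_gt0 d_ur] r_min {n n_gt0 dn ex_n}.
exists r => // n; rewrite /dvdn {1}(divn_eq n r) addnC.
have -> : (d%:Z %| u (n %% r + n %/ r * r)%N)%Z = (d%:Z %| u (n %% r)%N)%Z.
  elim: (n %/ r)%N => [|q IHq]; first by rewrite addn0.
  by rewrite mulSnr addnA (lucas_dvdz_addn a b).
case: (posnP (n %% r)) => [->|m_gt0]; first by have [-> _ _] := Lu; rewrite dvdz0.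
apply: contraTF (ltn_pmod n r_gt0) => d_um.
by rewrite -leqNgt r_min // m_gt0.
Qed.

(** * Lifting the exponent in Lucas sequences *)

(** First-order expansion in powers of u_n, by repeated addition of [n]; the second identity carries
    the induction. *)
Lemma lucas_muln_mod (a b : int) (u : nat -> int) (n j : nat) :
    lucas_sequence a b u ->
  exists y z, u (j.+1 * n)%N = u n * (j.+1%:Z * u n.+1 ^+ j + y * u n) /\
              u (j.+1 * n).+1 = u n.+1 ^+ j.+1 + z * u n.
Proof.
move=> Lu; elim: j => [|j [y [z [IH1 IH2]]]].
  by exists 0, 0; rewrite mul1n expr0 expr1; split; ring.
have [e1 e2] := lucas_addn _ _ _ (j.+1 * n) n Lu.
exists (z + y * u n.+1 - a * (j.+1%:Z * u n.+1 ^+ j + y * u n)).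
exists (z * u n.+1 + b * u n * (j.+1%:Z * u n.+1 ^+ j + y * u n)).
by rewrite mulSnr e1 e2 IH1 IH2 !exprS [in RHS]intS; split; ring.
Qed.

Lemma logn_eq1 (p m : nat) :
  prime p -> (p %| m)%N -> ~~ (p ^ 2 %| m)%N -> logn p m = 1%N.
Proof.
move=> p_pr pm p2m; have m_gt0 : (0 < m)%N by case: m p2m {pm} => //; rewrite dvdn0.
apply/eqP; rewrite eqn_leq -ltnS ltnNge -pfactor_dvdn // p2m.
by rewrite -pfactor_dvdn.
Qed.

(** Write u_(jn) = u_n c with c = j u_(n+1)^(j-1) mod u_n. If p does not divide j, then c is prime
    to p; if j = p, then c is p times a unit mod p^2, because p^2 divides u_n. The remaining j
    factor as ip with i > 1 and follow by induction. *)
Lemma lucas_logn_muln (a b : int) (u : nat -> int) (p n j : nat) :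
    lucas_sequence a b u -> (forall n, (0 < n)%N -> u n != 0) ->
    prime p -> coprimez p%:Z b -> ((p ^ 2)%N%:Z %| u n)%Z ->
    (0 < n)%N -> (0 < j)%N ->
  logn p `|u (j * n)%N| = (logn p j + logn p `|u n|)%N.
Proof.
move=> Lu u_neq0 p_pr pb; elim/ltn_ind: j n => j IHj n p2_un n_gt0 j_gt0.
have p_un : (p%:Z %| u n)%Z.
  by apply: dvdz_trans p2_un; rewrite dvdzE !absz_nat dvdn_mulr.
have p_pow i : coprimez p%:Z (u n.+1 ^+ i).
  exact/coprimezXr/(lucas_coprime_succ a b).
have [y [_ [uj _]]] := lucas_muln_mod _ _ _ n j.-1 Lu.
rewrite prednK // in uj; set c := _ + y * u n in uj.
have ujn_gt0 : (0 < `|u (j * n)%N|)%N.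
  by rewrite absz_gt0 u_neq0 // muln_gt0 j_gt0.
have log_uj : logn p `|u (j * n)%N| = (logn p `|c| + logn p `|u n|)%N.
  have c_gt0 : (0 < `|c|)%N.
    by rewrite absz_gt0; apply: contraTneq ujn_gt0 => c0; rewrite uj c0 mulr0.
  by rewrite uj abszM lognM 1?addnC ?c_gt0 ?absz_gt0 ?u_neq0.
case: (boolP (p %| j)%N) => [/dvdnP[i ji]|pj]; last first.
  rewrite log_uj; congr (_ + _)%N; rewrite lognE [RHS]lognE.
  suff -> : (p %| `|c|)%N = false by rewrite (negbTE pj) !andbF.
  have -> : (p %| `|c|)%N = (p%:Z %| c)%Z by rewrite dvdzE.
  rewrite /c dvdz_addr; last exact: dvdz_mull.
  rewrite Gauss_dvdzl // dvdzE.
  exact: negbTE.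
have i_gt0 : (0 < i)%N by rewrite lt0n; apply: contraTneq j_gt0 => i0; rewrite ji i0.
case: (ltnP 1 i) => [i_gt1|i_le1].
  have p_gt1 := prime_gt1 p_pr.
  have p_lt : (p < j)%N by rewrite ji -[X in (X < _)%N]mul1n ltn_pmul2r // ltnW.
  have i_lt : (i < j)%N by rewrite ji -[X in (X < _)%N]muln1 ltn_pmul2l.
  (* The induction hypothesis is used for [i] at the index pn, then for [p] at [n]; p^2 still
     divides u_(pn), a multiple of u_n. *)
  rewrite ji -mulnA IHj //; first last.
  - by rewrite muln_gt0 n_gt0 ltnW.
  - have [y' [_ [up _]]] := lucas_muln_mod _ _ _ n p.-1 Lu.
    rewrite (prednK (prime_gt0 p_pr)) in up.
    by rewrite up; apply: dvdz_mulr.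
  by rewrite IHj ?(ltnW p_gt1) // addnA lognM ?(ltnW p_gt1).
have i1 : i = 1%N by lia.
have jp : j = p by rewrite ji i1 mul1n.
rewrite log_uj; congr (_ + _)%N.
have -> : logn p j = 1%N by rewrite jp logn_prime ?eqxx.
apply: logn_eq1 => //.
  have -> : (p %| `|c|)%N = (p%:Z %| c)%Z by rewrite dvdzE.
  by rewrite /c dvdz_addr; [rewrite jp dvdz_mulr|apply: dvdz_mull].
have -> : (p ^ 2 %| `|c|)%N = ((p ^ 2)%N%:Z %| c)%Z by rewrite dvdzE.
rewrite /c dvdz_addr; last exact: dvdz_mull.
rewrite jp Gauss_dvdzl; last first.
  by rewrite coprimezE absz_nat coprimeXl; last exact: p_pow.
rewrite dvdzE !absz_nat; apply/negP => /(dvdn_leq (prime_gt0 p_pr)).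
by have := prime_gt1 p_pr; rewrite -mulnn; nia.
Qed.

(** * Nonvanishing of nondegenerate sequences *)

(** By Binet's formula, kept in the form (alpha - beta) u_n = alpha^n - beta^n to avoid a division,
    u_n = 0 would give (alpha/beta)^n = 1. *)
Lemma lucas_neq0 (a b : int) (u : nat -> int) (n : nat) :
    lucas_sequence a b u -> nondegenerate_recurrence a b -> (0 < n)%N ->
  u n != 0.
Proof.
move=> [u0 u1 uS] [b_neq0 nd] n_gt0.
pose A : algC := a%:~R; pose B : algC := b%:~R.
pose delta := sqrtC (A ^+ 2 + 4 * B).
have delta2 : delta ^+ 2 = A ^+ 2 + 4 * B by apply: sqrtCK.
pose alpha := (A + delta) / 2; pose beta := (A - delta) / 2.
have sumAB : alpha + beta = A by rewrite /alpha /beta; field.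
have prodAB : alpha * beta = - B.
  have -> : alpha * beta = (A ^+ 2 - delta ^+ 2) / 4 by rewrite /alpha /beta; field.
  by rewrite delta2; field.
have alpha2 : alpha ^+ 2 = A * alpha + B.
  by rewrite -sumAB -[B]opprK -prodAB; ring.
have beta2 : beta ^+ 2 = A * beta + B.
  by rewrite -sumAB -[B]opprK -prodAB; ring.
have factored : 'X^2 - a%:~R *: 'X - (b%:~R)%:P =
                ('X - alpha%:P) * ('X - beta%:P) :> {poly algC}.
  rewrite -/A -/B -[B]opprK -prodAB -sumAB -mul_polyC polyCN polyCM polyCD.
  by ring.
have beta_neq0 : beta != 0.
  apply: contraNneq b_neq0 => beta0.
  by move: prodAB; rewrite beta0 mulr0 => /esym/eqP; rewrite oppr_eq0 intr_eq0.
have := nd _ _ factored n n_gt0; rewrite unity_rootE; apply: contraNneq => un0.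
have binet m : (alpha - beta) * (u m)%:~R = alpha ^+ m - beta ^+ m /\
    (alpha - beta) * (u m.+1)%:~R = alpha ^+ m.+1 - beta ^+ m.+1.
  elim: m => [|m [IH1 IH2]]; first by rewrite u0 u1 !expr0 !expr1; split; ring.
  split=> //; rewrite uS rmorphD !rmorphM /= -/A -/B.
  have -> : (alpha - beta) * (A * (u m.+1)%:~R + B * (u m)%:~R) =
    A * ((alpha - beta) * (u m.+1)%:~R) + B * ((alpha - beta) * (u m)%:~R) by ring.
  rewrite IH1 IH2 -addn2 !exprD alpha2 beta2 !exprS; ring.
have [/esym/eqP] := binet n; rewrite un0 mulr0 subr_eq0 => /eqP alpha_n _.
by rewrite expr_div_n alpha_n divff // expf_neq0.
Qed.

(** * Powers of a composite k, and the ranks of apparition of k^d *)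

Lemma dvdn_exp_eq_logn (k d x y : nat) :
    (0 < k)%N -> (0 < x)%N -> (0 < y)%N ->
    (forall p, prime p -> (p %| k)%N -> logn p x = logn p y) ->
  (k ^ d %| x)%N = (k ^ d %| y)%N.
Proof.
move=> k_gt0 x_gt0 y_gt0 log_xy.
have kd_gt0 : (0 < k ^ d)%N by rewrite expn_gt0 k_gt0.
have part_xy p : p \in \pi((k ^ d)%N) -> ((k ^ d)`_p %| x)%N = ((k ^ d)`_p %| y)%N.
  rewrite mem_primes => /and3P[p_pr _].
  by rewrite Euclid_dvdX // => /andP[pk _]; rewrite p_part !pfactor_dvdn // log_xy.
by apply/dvdn_partP/dvdn_partP => // kd p p_kd; have := kd p p_kd; rewrite part_xy.
Qed.

(** Every prime p of [g] divides [k], and its exponent in [g] is less than [g]. This bounds the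
    needed power of [k] independently of [m]. *)
Lemma dvdn_exp_self (k m g : nat) :
  (0 < g)%N -> (g %| k ^ m)%N -> (g %| k ^ g)%N.
Proof.
move=> g_gt0 g_km; apply/dvdn_partP => // p.
rewrite mem_primes => /and3P[p_pr _ pg]; rewrite p_part.
have pk : (p %| k)%N.
  by have := dvdn_trans pg g_km; rewrite Euclid_dvdX // => /andP[].
apply: (@dvdn_trans (p ^ g)); last exact: dvdn_exp2r.
by apply/dvdn_exp2l/ltnW/ltn_logl.
Qed.

Theorem theorem1p3 (a b : int) (u : nat -> int)
    (u0 : u 0%N = 0) (u1 : u 1%N = 1)
    (uS : forall n : nat, u n.+2 = a * u n.+1 + b * u n)
    (hnd : nondegenerate_recurrence a b)
    (k : nat) (hk : (2 <= k)%N) (hkb : coprimez k%:Z b) :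
  k_regular k (fun n : nat => (nu k (u n.+1))%:Z).
Proof.
have Lu : lucas_sequence a b u by [].
have u_neq0 n : (0 < n)%N -> u n != 0 by apply: lucas_neq0 hnd.
have k_gt0 : (0 < k)%N by apply: ltnW.
have kXb d : coprimez (k ^ d)%N%:Z b.
  by move: hkb; rewrite !coprimezE !absz_nat; apply: coprimeXl.
have dvd_nu d n : (0 < n)%N -> (d <= nu k (u n))%N = ((k ^ d)%N%:Z %| u n)%Z.
  move=> n_gt0; rewrite -nuP ?u_neq0 //.
  by rewrite !dvdzE abszX.
have k2_gt1 : (1 < k ^ 2)%N by rewrite (ltn_exp2l 0).
(* The square of [k] provides p^2 dividing u_(n0) for every prime p dividing [k], as lifting the
   exponent requires. *)
have [n0 n0_gt0 n0_rank] := lucas_rank _ _ _ _ Lu k2_gt1 (kXb 2%N).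
pose V := `|u n0|%N.
have V_gt0 : (0 < V)%N by rewrite absz_gt0 u_neq0.
have k2_V : ((k ^ 2)%N%:Z %| u n0)%Z by rewrite n0_rank.
have lte d j : (0 < j)%N -> ((k ^ d)%N%:Z %| u (j * n0)%N)%Z = (k ^ d %| j * V)%N.
  move=> j_gt0; rewrite dvdzE absz_nat.
  apply: dvdn_exp_eq_logn => //.
  - by rewrite absz_gt0 u_neq0 // muln_gt0 j_gt0.
  - by rewrite muln_gt0 j_gt0.
  move=> p p_pr pk; rewrite lognM //; apply: (lucas_logn_muln a b) => //.
    by move: hkb; rewrite !coprimezE !absz_nat; apply: coprime_dvdl.
  by apply: dvdz_trans k2_V; rewrite dvdzE !absz_nat dvdn_exp2r.
(* [E] is at least [V], so that gcd(k^(E+t), V) no longer depends on t, and at least 2, so that k^E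
   dividing u_n forces [n0] to divide n. *)
pose E := V.+2; pose G := gcdn (k ^ E) V.
have G_gt0 : (0 < G)%N by rewrite gcdn_gt0 V_gt0 orbT.
have gcd_stable t : gcdn (k ^ (E + t)) V = G.
  apply/eqP; rewrite eqn_dvd !dvdn_gcd !dvdn_gcdr !andbT; apply/andP; split; last first.
    by apply: dvdn_trans (dvdn_gcdl _ _) _; apply/dvdn_exp2l/leq_addr.
  set g := gcdn _ _; have g_gt0 : (0 < g)%N by rewrite gcdn_gt0 V_gt0 orbT.
  apply: dvdn_trans (dvdn_exp_self k (E + t) g g_gt0 (dvdn_gcdl _ _)) _.
  apply/dvdn_exp2l/(@leq_trans V); last by rewrite /E; lia.
  exact/dvdn_leq/dvdn_gcdr.
pose T := (k ^ E %/ G * n0)%N.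
have dvd_mulV t j : (k ^ (E + t) %| j * V)%N = (k ^ t * (k ^ E %/ G) %| j)%N.
  have kEG : (k ^ E = k ^ E %/ G * G)%N by rewrite divnK ?dvdn_gcdl.
  have VG : (V = V %/ G * G)%N by rewrite divnK ?dvdn_gcdr.
  have kEtG : (k ^ (E + t) = k ^ t * (k ^ E %/ G) * G)%N.
    by rewrite -mulnA -kEG expnD mulnC.
  (* Cancel [G]: the cofactors of k^(E+t) and [V] are coprime, since [G] is their full gcd. *)
  rewrite kEtG VG mulnA dvdn_pmul2r // Gauss_dvdl //.
  have := gcd_stable t; rewrite kEtG [X in gcdn _ X]VG -muln_gcdl.
  by rewrite -[X in _ = X -> _]mul1n => /eqP; rewrite eqn_pmul2r.
have rank t n : (0 < n)%N -> ((k ^ (E + t))%N%:Z %| u n)%Z = (k ^ t * T %| n)%N.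
  move=> n_gt0; rewrite /T mulnA; case: (boolP (n0 %| n)%N) => [/dvdnP[j nj]|n0n].
    (* On multiples of [n0], divisibility of u_(j n0) is that of jV; off them both sides fail. *)
    rewrite nj dvdn_pmul2r // lte ?dvd_mulV //.
    by rewrite lt0n; apply: contraTneq n_gt0 => j0; rewrite nj j0.
  transitivity false; last first.
    by apply/esym; apply: contraNF n0n; apply: dvdn_trans; apply: dvdn_mull.
  apply: contraNF n0n => kn; rewrite -n0_rank; apply: dvdz_trans kn.
  by rewrite dvdzE !absz_nat dvdn_exp2l.
have T_gt0 : (0 < T)%N.
  by rewrite muln_gt0 n0_gt0 andbT divn_gt0 // dvdn_leq ?dvdn_gcdl // expn_gt0 k_gt0.
apply: (k_regular_of_periodicity k E T (fun n => nu k (u n))) => // [d n dE|t n] n_gt0.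
  rewrite !dvd_nu ?addn_gt0 ?n_gt0 //; apply: (lucas_dvdz_addn a b) => //.
  (* The case t = 0 at n = [T] shows that k^E divides u_T, so shifting by [T] preserves divisibility
     by k^d for d <= E. *)
  have : ((k ^ (E + 0))%N%:Z %| u T)%Z by rewrite rank // mul1n.
  by apply: dvdz_trans; rewrite dvdzE !absz_nat dvdn_exp2l // addn0.
by rewrite dvd_nu // rank.
Qed.
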